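(* There are absolute constants $c_3 \in (0,1)$ and $C_1,C_2,C_3 > 0$ such that the following holds for all sufficiently large $x_0$ and all $\eta,\delta\in(0,1)$: (a) if $d\ge1$ and $f \in \mathcal{M}_1(x_0;d)$ with $$C_1\, \rho\big(\tfrac{C_2}{\eta \delta}\big)^{-1} \leq d \leq \tfrac{C_3}{\eta \delta}\, e^{(\log x_0)^{c_3}},$$ then for every $x > x_0^{\delta}$, $$\sum_{\substack{p \leq x \\ f(p) \neq 0,1}} \frac{1}{p} \geq \log(1/\eta);$$ (b) if $f\in\mathcal{M}_1(x_0;d)$ is, in addition, a primitive Dirichlet character modulo a sufficiently large prime $q$ with $d\mid(q-1)$, and $\eta \delta \geq (\log q)^{-c}$ for some $0 < c < c_3$, then the same conclusion as in (a) holds assuming only the lower bound $d\ge C_1\rho(\tfrac{C_2}{\eta\delta})^{-1}$ (i.e. without the upper bound on $d$).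
   Context: Sums over $p$ are over primes. $\mu_d$ is the set of complex $d$-th roots of unity. $\rho:[0,\infty)\to\mathbb{R}$ is the Dickman–de Bruijn function: the unique continuous solution of $u\rho'(u)+\rho(u-1)=0$ for $u>1$ with $\rho(u)=1$ for $u\in[0,1]$. For $d\in\mathbb{N}$ and $x_0\ge1$, $\mathcal{M}(x_0;d)$ is the set of completely multiplicative functions $f:\mathbb{N}\to\mu_d\cup\{0\}$ such that for every $x\ge x_0$, $$\max_{\alpha\in\mu_d}|\{n\le x: f(n)=\alpha\}|\le \frac{100x}{d}\prod_{\substack{p\le x\\ f(p)=0}}\Big(1-\frac1p\Big).$$ $\mathcal{M}_1(x_0;d)$ is the set of $f\in\mathcal{M}(x_0;d)$ satisfying additionally $\sum_{p:\,f(p)=0}\frac1p\le 100$. *)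

(* Defs.v *)
From HB Require Import structures.
From mathcomp Require Import all_boot all_order all_algebra all_field.
From mathcomp Require Import all_classical all_reals all_analysis.
Set Implicit Arguments. Unset Strict Implicit. Unset Printing Implicit Defensive.
Import Order.TTheory GRing.Theory Num.Theory.
Import numFieldNormedType.Exports.
Local Open Scope ring_scope.
Local Open Scope classical_set_scope.

Definition is_dickman_rho (R : realType) (rho : R -> R) : Prop :=
  {within [set u : R | 0 <= u], continuous rho} /\
  (forall u : R, 0 <= u <= 1 -> rho u = 1) /\
  (forall u : R, 1 < u -> is_derive u 1 rho (- (rho (u - 1)) / u)).

Definition completely_mult (f : nat -> algC) : Prop :=
  f 1%N = 1 /\ forall m n : nat, (0 < m)%N -> (0 < n)%N -> f (m * n)%N = f m * f n.

Definition values_in_mu0 (d : nat) (f : nat -> algC) : Prop :=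
  forall n : nat, (0 < n)%N -> f n = 0 \/ f n ^+ d = 1.

Definition sum_inv_primes_upto (R : realType) (x : R) (P : nat -> bool) : R :=
  \sum_(p < (Num.truncn x).+1 | prime p && P p) (p%:R)^-1.

Definition prod_zero_primes_upto (R : realType) (x : R) (f : nat -> algC) : R :=
  \prod_(p < (Num.truncn x).+1 | prime p && (f p == 0)) (1 - (p%:R)^-1).

Definition count_upto (R : realType) (x : R) (f : nat -> algC) (a : algC) : nat :=
  count (fun n => f n == a) (iota 1 (Num.truncn x)).

Definition classM (R : realType) (x0 : R) (d : nat) (f : nat -> algC) : Prop :=
  completely_mult f /\ values_in_mu0 d f /\
  forall x : R, x0 <= x -> forall a : algC, a ^+ d = 1 ->
    (count_upto x f a)%:R <= 100 * x / d%:R * prod_zero_primes_upto x f.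

(* the class M_1(x0; d): additionally sum_{p : f(p) = 0} 1/p <= 100,
   i.e. all partial sums of this series of nonnegative terms are <= 100 *)
Definition classM1 (R : realType) (x0 : R) (d : nat) (f : nat -> algC) : Prop :=
  classM x0 d f /\
  forall N : nat, \sum_(p < N | prime p && (f p == 0)) ((p%:R : R)^-1) <= 100.

Definition dirichlet_char (q : nat) (f : nat -> algC) : Prop :=
  completely_mult f /\ (forall n : nat, f (n + q)%N = f n) /\
  (forall n : nat, (f n == 0) = ~~ coprime n q).

(* primitive: no proper divisor q' of q is an induced modulus, i.e. for every
   q' | q with q' < q there is n coprime to q, n = 1 mod q', with f n <> 1 *)
Definition primitive_char (q : nat) (f : nat -> algC) : Prop :=
  dirichlet_char q f /\
  forall q' : nat, (q' %| q)%N -> (q' < q)%N ->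
    exists n : nat, [/\ coprime n q, n = 1 %[mod q'] & f n != 1].

(* Main.v *)
(* Suppose the sum over p <= x of 1/p with f(p) <> 0, 1 is less than log(1/eta).
   Put y = x0^delta, log w = (eta / e^107) log y and t = 1/(eta delta). The primes
   p <= y with f(p) <> 1 have reciprocal sum at most log(1/eta) + 100, so Mertens'
   theorem leaves primes w < p <= y with f(p) = 1 of reciprocal sum at least 1.
   Consider n = m p_1 ... p_k with p_i among these primes, m <= w composed of primes
   where f = 1, and w^k >= x0^2, so that k = O(t). Then f(n) = 1 and n > x0, and a
   one-sided sieve for m gives sum 1/n >= c eta (log w) / k!. On the other hand
   f is in M(x0; d), so partial summation bounds this sum by
   (100/d) (1 + (k+1) log y). Hence d = O(k! k^3), which contradicts
   d >= C1 / rho(C2 t) since rho(u) <= 1/floor(u)!. Averaging n with weight 1/n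
   replaces Hildebrand's lower bound for sieved integers. *)
Require Import Defs.
From HB Require Import structures.
From mathcomp Require Import all_boot all_order all_algebra all_field.
From mathcomp Require Import all_classical all_reals all_analysis.
From mathcomp Require Import zify ring lra.
Import Order.TTheory GRing.Theory Num.Theory.
Import numFieldNormedType.Exports.
Local Open Scope ring_scope.

(** * Reciprocal sums over lists, the sieve, and products of primes *)

Lemma ler_sum_subseq_pos (R : numDomainType) (s t : seq nat) (F : nat -> R) :
  uniq s -> uniq t -> {subset s <= t} -> (forall n, n \in t -> 0 <= F n) ->
  \sum_(n <- s) F n <= \sum_(n <- t) F n.
Proof.
move=> us ut st F0.
have -> : \sum_(n <- s) F n = \sum_(n <- t | n \in s) F n.
  rewrite -[RHS]big_filter; apply: perm_big; apply: uniq_perm => //.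
    exact: filter_uniq.
  by move=> n; rewrite mem_filter andb_idr //; exact: st.
rewrite big_mkcond /= !big_seq; apply: ler_sum => n nt.
by case: ifP => // _; exact: F0.
Qed.

Definition recip_sum (R : realType) (s : seq nat) : R := \sum_(n <- s) (n%:R)^-1.

Lemma recip_sum_le (R : realType) (s t : seq nat) :
  uniq s -> uniq t -> {subset s <= t} -> recip_sum R s <= recip_sum R t.
Proof.
by move=> us ut st; apply: ler_sum_subseq_pos => // n _; rewrite invr_ge0.
Qed.

Lemma recip_sum_ge0 (R : realType) (s : seq nat) : 0 <= recip_sum R s.
Proof. by apply: sumr_ge0 => n _; rewrite invr_ge0. Qed.

Definition free_of (Q : seq nat) (n : nat) : bool :=
  all (fun q => ~~ (q %| n)%N) Q.

(* Each q in Q removes at most a proportion 1/q of the sum, because division by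
   q maps the removed terms injectively into those that were present. *)
Lemma sieve_recip_sum (R : realType) (Q : seq nat) (N : nat) :
  all (leq 1) Q ->
  (\prod_(q <- Q) (1 - (q%:R)^-1)) * recip_sum R (iota 1 N)
    <= recip_sum R [seq n <- iota 1 N | free_of Q n].
Proof.
elim: Q => [|q Q IH] /=; first by rewrite big_nil mul1r filter_predT.
case/andP => q0 /IH {}IH; rewrite big_cons -mulrA.
set A := [seq n <- iota 1 N | free_of Q n] in IH *.
have q1 : 0 <= 1 - (q%:R : R)^-1.
  by rewrite subr_ge0 invf_le1 ?ler1n ?ltr0n.
apply: (le_trans (ler_wpM2l q1 IH)).
set A' := [seq n <- iota 1 N | _].
have -> : A' = [seq n <- A | ~~ (q %| n)%N].
  by rewrite -filter_predI; apply: eq_filter.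
rewrite mulrBl mul1r lerBlDr /recip_sum.
rewrite [leLHS](bigID (fun n => ~~ (q %| n)%N)) /= big_filter lerD2l.
have -> : \sum_(i <- A | ~~ ~~ (q %| i)%N) (i%:R : R)^-1
   = q%:R^-1 * \sum_(i <- [seq (n %/ q)%N | n <- A & (q %| n)%N]) (i%:R)^-1.
  rewrite big_map big_filter mulr_sumr; apply: eq_big => n; first by rewrite negbK.
  by rewrite negbK => qn; rewrite -invfM -natrM mulnC divnK.
rewrite ler_wpM2l ?invr_ge0 //; apply: ler_sum_subseq_pos.
- rewrite map_inj_in_uniq ?filter_uniq ?iota_uniq // => m n.
  rewrite !mem_filter => /andP[qm _] /andP[qn _] e.
  by rewrite -(divnK qm) e divnK.
- by rewrite filter_uniq // iota_uniq.
- move=> m /mapP[n]; rewrite !mem_filter => /and3P[qn fn].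
  rewrite !mem_iota => /andP[n1 nN] ->; apply/andP; split.
    apply/allP => r rQ; apply: contra (allP fn r rQ) => rn.
    by rewrite -(divnK qn) dvdn_mulr.
  by rewrite divn_gt0 // dvdn_leq //= (leq_ltn_trans (leq_div _ _)).
- by move=> n _; rewrite invr_ge0.
Qed.

(** The prime factors may repeat. One integer can arise from several ordered choices of them, and
    [undup] keeps it once, so that reciprocal sums run over a set of integers. *)
Fixpoint prime_products (P E : seq nat) (j : nat) : seq nat :=
  if j is i.+1 then undup [seq (p * n)%N | p <- P, n <- prime_products P E i]
  else E.

Lemma prime_products_uniq P E j : uniq E -> uniq (prime_products P E j).
Proof. by case: j => [|j] //= _; exact: undup_uniq. Qed.

Lemma prime_products_ind (P E : seq nat) (T : nat -> nat -> Prop) :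
  (forall n, n \in E -> T 0%N n) ->
  (forall j p n, p \in P -> T j n -> T j.+1 (p * n)%N) ->
  forall j n, n \in prime_products P E j -> T j n.
Proof.
move=> T0 TS; elim=> [|j IH] n /=; first exact: T0.
rewrite mem_undup => /allpairsP[[p m] /= [pP mE ->]].
by apply: TS => //; exact: IH.
Qed.

(** Expanding one more factor [recip_sum R P] produces each n at most once for every p in P dividing
    n. Since elements of E have no divisor in P, there are at most j + 1 such p at stage j + 1, and
    these losses multiply to the factorial. *)
Lemma prime_products_mass (R : realType) (P E : seq nat) (j : nat) :
  uniq P -> all prime P -> uniq E ->
  (forall n, n \in E -> count (fun p => p %| n)%N P = 0%N) ->
  recip_sum R P ^+ j * recip_sum R E <= j`!%:R * recip_sum R (prime_products P E j).
Proof.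
move=> uP /allP prP uE PE.
have div_count : forall i n, n \in prime_products P E i ->
    (count (fun p => p %| n)%N P <= i)%N.
  apply: prime_products_ind => [n nE|i p n pP IH]; first by rewrite PE.
  have -> : i.+1 = ((p \in P) + i)%N by rewrite pP.
  rewrite -(count_uniq_mem p uP) (leq_trans _ (leq_add (leqnn _) IH)) //.
  rewrite -count_predUI (leq_trans _ (leq_addr _ _)) //.
  have -> : count (fun q => q %| p * n)%N P
     = count (fun q => (q \in P) && (q %| p * n)%N) P.
    by apply: eq_in_count => q ->.
  apply: sub_count => q /= /andP[qP].
  rewrite Euclid_dvdM ?prP // => /orP[|->]; last by rewrite orbT.
  by rewrite dvdn_prime2 ?prP // => ->.
elim: j => [|j IH]; first by rewrite expr0 fact0 !mul1r.
rewrite exprS -mulrA (le_trans (ler_wpM2l (recip_sum_ge0 _ _) IH)) //.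
rewrite mulrCA factS mulnC natrM -mulrA ler_wpM2l //=.
set F := prime_products P E j; set S := [seq _ | _ <- _, _ <- _].
have -> : recip_sum R P * recip_sum R F = \sum_(n <- S) (n%:R)^-1.
  rewrite big_allpairs_dep /= /recip_sum mulr_suml; apply: eq_bigr => p _.
  by rewrite mulr_sumr; apply: eq_bigr => n _; rewrite natrM invfM.
(* Regroup the expanded sum by distinct values; it remains to bound the multiplicity of n in [S] by
   [j.+1]. *)
rewrite -big_undup_iterop_count /= mulr_sumr !big_seq; apply: ler_sum => n nS.
have -> : iterop (count_mem n S) +%R (n%:R : R)^-1 0 = (n%:R)^-1 *+ count_mem n S.
  by [].
rewrite -[leLHS]mulr_natl ler_wpM2r ?invr_ge0 // ler_nat.
apply: (leq_trans _ (div_count j.+1 n nS)).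
(* For fixed p the equation p m = n has at most the solution m = n / p, and none unless p divides
   n. *)
have key s : all prime s ->
    (sumn [seq count_mem n [seq (p * m)%N | m <- F] | p <- s]
      <= count (fun p => p %| n)%N s)%N.
  elim: s => //= p s IHs /andP[pp /IHs {}IHs]; rewrite leq_add //.
  rewrite count_map; case: (boolP (p %| n)%N) => [pn|pn] /=.
    rewrite (@eq_count _ _ (pred1 (n %/ p)%N)).
      by rewrite count_uniq_mem ?leq_b1 ?prime_products_uniq.
    by move=> m /=; rewrite eqn_div ?prime_gt0 // mulnC.
  rewrite leqn0; apply/eqP; rewrite (@eq_count _ _ pred0) ?count_pred0 // => m /=.
  by apply: contraNF pn => /eqP <-; rewrite dvdn_mulr.
by rewrite /S count_flatten -map_comp; apply: key; apply/allP.
Qed.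

(** * Mertens' theorem up to a constant factor *)

(** The error is quadratic so that, over t = 1/p, it sums to a constant. It follows from e^s >= 1 +
    s and (1 - t)(1 + t + 2t^2) = 1 + t^2(1 - 2t) >= 1. *)
Lemma expR_le_1sub (R : realType) (t : R) : 0 <= t <= 1 / 2 ->
  expR (- (t + 2 * t ^+ 2)) <= 1 - t.
Proof.
move=> /andP[t0 t2]; rewrite expRN.
have h := expR_ge1Dx (t + 2 * t ^+ 2).
have e0 := expR_gt0 (t + 2 * t ^+ 2).
have h2 : 1 <= (1 - t) * (1 + (t + 2 * t ^+ 2)) by nra.
rewrite -[leLHS]mul1r ler_pdivrMr //.
by apply: (le_trans h2); rewrite ler_wpM2l //; lra.
Qed.

Lemma expR_le_1add (R : realType) (t : R) : 0 <= t <= 1 ->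
  expR (t - t ^+ 2) <= 1 + t.
Proof.
move=> /andP[t0 t1]; rewrite -[t - _]opprK expRN.
have h := expR_ge1Dx (- (t - t ^+ 2)).
have h1 : 1 <= (1 + t) * (1 + - (t - t ^+ 2)) by nra.
rewrite -[leLHS]mul1r ler_pdivrMr ?expR_gt0 //.
by apply: (le_trans h1); rewrite ler_wpM2l //; lra.
Qed.

Lemma lnS_le (R : realType) (n : nat) : (0 < n)%N ->
  ln (n.+1%:R : R) <= ln n%:R + n%:R^-1.
Proof.
move=> n0; have n0R : (0 : R) < n%:R by rewrite ltr0n.
have -> : (n.+1%:R : R) = n%:R * (1 + n%:R^-1).
  by rewrite mulrDr mulr1 divff ?gt_eqF // -natr1.
rewrite lnM ?posrE ?addr_gt0 ?invr_gt0 // lerD2l.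
by apply: le_ln1Dx; rewrite (lt_trans (ltrN10 _)) ?invr_gt0.
Qed.

Lemma lnS_ge (R : realType) (n : nat) : (0 < n)%N ->
  ln (n%:R : R) + n.+1%:R^-1 <= ln n.+1%:R.
Proof.
move=> n0; have n0R : (0 : R) < n%:R by rewrite ltr0n.
have i1 : (n.+1%:R : R)^-1 < 1 by rewrite invf_lt1 ?ltr0n // ltr1n ltnS.
have e : (n%:R : R) = n.+1%:R * (1 + - n.+1%:R^-1).
  by rewrite mulrDr mulr1 mulrN divff ?pnatr_eq0 // -natr1 addrK.
rewrite {1}e lnM ?posrE ?ltr0n ?subr_gt0 // -addrA gerDl.
by rewrite -lerBrDr sub0r; apply: le_ln1Dx; rewrite ltrN2.
Qed.

Lemma recip_sum_iota_ge (R : realType) (N : nat) :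
  ln (N.+1%:R : R) <= recip_sum R (iota 1 N).
Proof.
elim: N => [|N IH]; first by rewrite /recip_sum big_nil ln1.
rewrite /recip_sum -[N.+1]addn1 iotaD big_cat /= big_seq1 add1n addn1.
by apply: (le_trans (lnS_le R N.+1 _)) => //; rewrite lerD2r.
Qed.

Lemma recip_sum_iota_le (R : realType) (m N : nat) : (0 < m)%N ->
  recip_sum R (iota m.+1 N) <= ln (m + N)%:R - ln m%:R.
Proof.
move=> m0; elim: N => [|N IH]; first by rewrite /recip_sum big_nil addn0 subrr.
rewrite /recip_sum -[N.+1]addn1 iotaD big_cat /= big_seq1 addSn.
have := lnS_ge R (m + N); rewrite addn_gt0 m0 => /(_ isT).
by rewrite addnA addn1 => h; rewrite (le_trans (lerD IH (lexx _))) // addrAC lerD2r.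
Qed.

Lemma sum_inv_sq_le1 (R : realType) (s : seq nat) : uniq s -> all (leq 2) s ->
  \sum_(n <- s) ((n%:R : R)^-1) ^+ 2 <= 1.
Proof.
move=> us /allP s2.
(* Telescoping of 1/n^2 <= 1/(n-1) - 1/n; the last element of [iota 2 N] is N + 1. *)
have h N : \sum_(n <- iota 2 N) ((n%:R : R)^-1) ^+ 2 <= 1 - N.+1%:R^-1.
  elim: N => [|N IH]; first by rewrite big_nil invr1 subrr.
  rewrite -[N.+1]addn1 iotaD big_cat /= big_seq1.
  apply: (le_trans (lerD IH (lexx _))).
  rewrite addn1 add2n.
  have e : (N.+2%:R : R) = N.+1%:R + 1 by rewrite natr1.
  have n0 : (0 : R) < N.+1%:R by rewrite ltr0n.
  rewrite e; move: (N.+1%:R : R) n0 => x x0.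
  have h1 : (x + 1)^-1 ^+ 2 <= x^-1 - (x + 1)^-1.
    have -> : x^-1 - (x + 1)^-1 = x^-1 * (x + 1)^-1.
      by field; rewrite !gt_eqF //; lra.
    have x1 : 0 < x + 1 by lra.
    by rewrite expr2 ler_wpM2r ?invr_ge0 ?(ltW x1) // lef_pV2 ?posrE // lerDl.
  by lra.
pose N := (\max_(n <- s) n)%N.
apply: (@le_trans _ _ (\sum_(n <- iota 2 N) ((n%:R : R)^-1) ^+ 2)); last first.
  by apply: (le_trans (h N)); rewrite gerDl oppr_le0 invr_ge0.
apply: ler_sum_subseq_pos; [exact: us|exact: iota_uniq| |].
  move=> n ns; rewrite mem_iota s2 //= addnC addn2 ltnS ltnW // ltnS.
  by rewrite /N; apply: (leq_bigmax_seq (F := id)).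
by move=> n _; rewrite exprn_ge0 ?invr_ge0.
Qed.

Lemma prod_1sub_ge (R : realType) (Q : seq nat) : uniq Q -> all prime Q ->
  expR (- (recip_sum R Q + 2)) <= \prod_(q <- Q) (1 - (q%:R : R)^-1).
Proof.
move=> uQ /allP pQ.
have Q2 : all (leq 2) Q by apply/allP => q /pQ /prime_gt1.
apply: (@le_trans _ _
  (\prod_(q <- Q) expR (- ((q%:R : R)^-1 + 2 * (q%:R^-1) ^+ 2)))).
  rewrite -expR_sum ler_expR sumrN lerN2 big_split /= -mulr_sumr lerD2l.
  have := sum_inv_sq_le1 R _ uQ Q2; lra.
rewrite !big_seq; apply: ler_prod => q qQ; rewrite expR_ge0 /=.
apply: expR_le_1sub; rewrite invr_ge0 ler0n /=.
by rewrite div1r lef_pV2 ?posrE ?ltr0n ?(prime_gt0 (pQ q qQ)) // ler_nat prime_gt1 ?pQ.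
Qed.

Definition primes_upto (N : nat) : seq nat := [seq p <- iota 1 N | prime p].

Lemma mem_primes_upto N p : (p \in primes_upto N) = prime p && (p <= N)%N.
Proof.
rewrite mem_filter mem_iota add1n ltnS; case: (boolP (prime p)) => //= pp.
by rewrite prime_gt0.
Qed.

Lemma primes_upto_uniq N : uniq (primes_upto N).
Proof. by rewrite filter_uniq // iota_uniq. Qed.

Lemma primes_upto_prime N : all prime (primes_upto N).
Proof. exact: filter_all. Qed.

(** Sieving 1, ..., N by all primes up to N leaves only 1, so the product of the 1 - 1/p times the
    harmonic sum is at most 1. *)
Lemma mertens_lower (R : realType) (N : nat) :
  ln (N.+1%:R : R) <= expR (recip_sum R (primes_upto N) + 2).
Proof.
have [->|N0] := posnP N; first by rewrite ln1 expR_ge0.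
have h1 : all (leq 1) (primes_upto N).
  by apply/allP => p; rewrite mem_primes_upto => /andP[/prime_gt0].
have := sieve_recip_sum R (primes_upto N) N h1.
have -> : [seq n <- iota 1 N | free_of (primes_upto N) n] = [:: 1%N].
  have e : [seq n <- iota 1 N | free_of (primes_upto N) n]
      = [seq n <- iota 1 N | pred1 1%N n].
    apply: eq_in_filter => n; rewrite mem_iota add1n ltnS => /andP[n1 nN].
    apply/allP/eqP => [h|-> p]; last first.
      by rewrite mem_primes_upto dvdn1 => /andP[/prime_gt1]; case: p => [|[|]].
    case: (leqP n 1) => [|n2]; first by case: (n) n1 => [|[|]].
    have pP : pdiv n \in primes_upto N.
      rewrite mem_primes_upto; apply/andP; split; first exact: pdiv_prime.
      by apply: leq_trans nN; apply: pdiv_leq; exact: n1.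
    by have /negP[] := h _ pP; exact: pdiv_dvd.
  rewrite e filter_pred1_uniq ?iota_uniq // mem_iota /=; lia.
rewrite {2}/recip_sum big_seq1 invr1 => h.
have g0 := prod_1sub_ge R _ (primes_upto_uniq N) (primes_upto_prime N).
have l0 : 0 <= ln (N.+1%:R : R) by rewrite ln_ge0 // ler1n.
have := le_trans (ler_pM (expR_ge0 _) l0 g0 (recip_sum_iota_ge R N)) h.
rewrite expRN mulrC ler_pdivrMr ?expR_gt0 ?mul1r //.
Qed.

Lemma prod_prime_powers_dvd (s : seq nat) (a : nat -> nat) (M : nat) :
  uniq s -> all prime s -> (forall p, p \in s -> p ^ a p %| M)%N ->
  (\prod_(p <- s) p ^ a p %| M)%N.
Proof.
elim: s => [|p s IH] /=; first by rewrite big_nil dvd1n.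
move=> /andP[ps us] /andP[pp als] h; rewrite big_cons Gauss_dvd.
  apply/andP; split; first by apply: h; exact: mem_head.
  by apply: IH => // q qs; apply: h; rewrite inE qs orbT.
rewrite coprimeXl // big_seq.
elim/big_rec: _ => [|q x qs cx]; first exact: coprimen1.
rewrite coprimeMr cx andbT coprimeXr // prime_coprime // dvdn_prime2 ?(allP als q) //.
by apply: contraNN ps => /eqP ->.
Qed.

(* Legendre's formula for N!, with floor(N/p) >= N/(2p) in place of a bound on
   the Chebyshev function. *)
Lemma sum_ln_div_prime_le (R : realType) (N : nat) : (0 < N)%N ->
  \sum_(p <- primes_upto N) ln (p%:R : R) / p%:R <= 2 * ln N%:R.
Proof.
move=> N0; have N0R : (0 : R) < N%:R by rewrite ltr0n.
have ps p : p \in primes_upto N -> prime p /\ (p <= N)%N.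
  by rewrite mem_primes_upto => /andP.
have dv : (\prod_(p <- primes_upto N) p ^ (N %/ p) %| N`!)%N.
  apply: prod_prime_powers_dvd (primes_upto_uniq N) (primes_upto_prime N) _.
  move=> p /ps[pp pN]; rewrite pfactor_dvdn ?fact_gt0 // logn_fact //.
  by rewrite big_ltn // expn1 leq_addr.
have fN : (N`! <= N ^ N)%N.
  have : forall n, (n <= N -> n`! <= N ^ n)%N.
    elim=> [|n IH] nN; first by rewrite expn0.
    by rewrite factS expnS leq_mul // IH // ltnW.
  exact.
have le1 := leq_trans (dvdn_leq (fact_gt0 N) dv) fN.
have le2 : \sum_(p <- primes_upto N) ((N %/ p)%:R * ln (p%:R : R))
    <= N%:R * ln N%:R.
  rewrite !mulr_natl -lnXn //.
  have -> : \sum_(p <- primes_upto N) (N %/ p)%:R * ln (p%:R : R)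
     = ln ((\prod_(p <- primes_upto N) p ^ (N %/ p))%N%:R).
    have : {in primes_upto N, forall p, (0 < p)%N}.
      by move=> p /ps[/prime_gt0].
    elim: (primes_upto N) => [|p s IH] s0; first by rewrite !big_nil ln1.
    rewrite !big_cons IH; last by move=> q qs; apply: s0; rewrite inE qs orbT.
    have p0 : (0 < p)%N by rewrite s0 ?mem_head.
    rewrite natrM lnM ?posrE ?ltr0n ?expn_gt0 ?p0 //; last first.
      rewrite big_seq prodn_cond_gt0 // => q qs.
      by rewrite expn_gt0 s0 // inE qs orbT.
    by rewrite natrX lnXn ?ltr0n // mulr_natl.
  rewrite ler_ln ?posrE ?exprn_gt0 // ?ltr0n.
    by rewrite -natrX ler_nat.
  by rewrite big_seq prodn_cond_gt0 // => q /ps[/prime_gt0 q0 _]; rewrite expn_gt0 q0.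
rewrite -(ler_pM2l N0R) [leRHS]mulrCA.
apply: (@le_trans _ _
  (2 * \sum_(p <- primes_upto N) ((N %/ p)%:R * ln (p%:R : R)))); last first.
  by rewrite ler_wpM2l.
rewrite !mulr_sumr !big_seq; apply: ler_sum => p /ps[pp pN].
have p0 : (0 : R) < p%:R by rewrite ltr0n prime_gt0.
have -> : N%:R * (ln (p%:R : R) / p%:R) = N%:R / p%:R * ln p%:R by ring.
rewrite mulrA ler_wpM2r //.
  by rewrite ln_ge0 // ler1n prime_gt0.
rewrite ler_pdivrMr // -!natrM ler_nat.
have := divn_eq N p; have := ltn_pmod N (prime_gt0 pp).
have : (0 < N %/ p)%N by rewrite divn_gt0 ?prime_gt0.
nia.
Qed.

(** The term n^(-s) of the zeta series at s = 1 + 1/l. *)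
Definition zeta_term (R : realType) (l : R) (n : nat) : R :=
  expR (- ((1 + l^-1) * ln n%:R)).

Lemma zeta_term1 (R : realType) (l : R) : zeta_term R l 1 = 1.
Proof. by rewrite /zeta_term ln1 mulr0 oppr0 expR0. Qed.

Lemma zeta_termM (R : realType) (l : R) (m n : nat) : (0 < m)%N -> (0 < n)%N ->
  zeta_term R l (m * n) = zeta_term R l m * zeta_term R l n.
Proof.
move=> m0 n0; rewrite /zeta_term natrM lnM ?posrE ?ltr0n //.
by rewrite mulrDr opprD expRD.
Qed.

Lemma zeta_termE (R : realType) (l : R) (n : nat) : (0 < n)%N ->
  zeta_term R l n = n%:R^-1 * expR (- (l^-1 * ln n%:R)).
Proof.
move=> n0; rewrite /zeta_term mulrDl mul1r opprD expRD; congr (_ * _).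
by rewrite expRN lnK // posrE ltr0n.
Qed.

Lemma zeta_sum_le (R : realType) (l : R) (N : nat) : 0 < l ->
  \sum_(n <- iota 1 N) zeta_term R l n <= 1 + l.
Proof.
move=> l0; case: N => [|N]; first by rewrite big_nil; lra.
(* Integral comparison in a form fit for induction: the subtracted term is the integral of t^(-s)
   from N + 1 to infinity. *)
suff : \sum_(n <- iota 1 N.+1) zeta_term R l n
    <= 1 + l - l * expR (- (l^-1 * ln N.+1%:R)).
  by have := mulr_gt0 l0 (expR_gt0 (- (l^-1 * ln N.+1%:R))); lra.
elim: N => [|N IH].
  by rewrite big_seq1 zeta_term1 ln1 mulr0 oppr0 expR0; lra.
rewrite -[N.+2]addn1 iotaD big_cat /= big_seq1 addn1 add1n.
apply: (le_trans (lerD IH (lexx _))).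
rewrite zeta_termE //.
set b := ln N.+2%:R; set c := ln N.+1%:R.
have bc : (N.+2%:R : R)^-1 <= b - c by rewrite lerBrDl; exact: lnS_ge.
have -> : - (l^-1 * c) = - (l^-1 * b) + l^-1 * (b - c) by ring.
rewrite expRD; have h := expR_ge1Dx (l^-1 * (b - c)).
have e0 := expR_gt0 (- (l^-1 * b)).
set x := expR (- (l^-1 * b)) in e0 *; set y := expR _ in h *.
have h2 : l * (x * (1 + l^-1 * (b - c))) <= l * (x * y).
  by rewrite !ler_pM2l.
have h3 : l * (x * (1 + l^-1 * (b - c))) = l * x + x * (b - c).
  by rewrite mulrDr mulr1 mulrDr [x * (_ * _)]mulrCA mulVKf ?gt_eqF.
have h4 : N.+2%:R^-1 * x <= x * (b - c) by rewrite mulrC ler_pM2l.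
by move: (b - c) (N.+2%:R^-1 * x) h2 h3 h4 => u v h2 h3 h4; lra.
Qed.

(** One product for each sublist of P, in correspondence with the terms of the expanded product of
    the factors 1 + p^(-s). *)
Fixpoint squarefree_products (P : seq nat) : seq nat :=
  if P is p :: Q then
    squarefree_products Q ++ [seq (p * n)%N | n <- squarefree_products Q]
  else [:: 1%N].

Lemma squarefree_products_dvd P n : n \in squarefree_products P ->
  (n %| \prod_(p <- P) p)%N.
Proof.
elim: P n => [|p P IH] n /=; first by rewrite inE big_nil dvdn1.
rewrite mem_cat big_cons => /orP[/IH nP|/mapP[m /IH mP ->]].
  exact: dvdn_mull.
exact: dvdn_mul.
Qed.

Lemma squarefree_products_uniq P : uniq P -> all prime P ->
  uniq (squarefree_products P).
Proof.
elim: P => //= p P IH /andP[pP uP] /andP[pp aP]; rewrite cat_uniq IH //=.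
rewrite map_inj_uniq ?IH //; last first.
  by move=> m n /eqP; rewrite eqn_pmul2l ?prime_gt0 // => /eqP.
rewrite andbT; apply/hasPn => n /mapP[m _ ->].
apply/negP => /squarefree_products_dvd h.
have : (p %| \prod_(q <- P) q)%N by apply: dvdn_trans h; exact: dvdn_mulr.
move: (aP) pP; elim: (P) => [|q Q IHQ] /=.
  by rewrite big_nil dvdn1 => _ _ /eqP p1; rewrite p1 in pp.
rewrite inE negb_or => /andP[qp aQ] /andP[pq pQ].
by rewrite big_cons Euclid_dvdM // dvdn_prime2 // (negbTE pq); exact: IHQ.
Qed.

(** With factors 1 + p^(-s) the expansion is finite. Its terms belong to distinct squarefree
    divisors of the product of P, so it is part of the sum over all n up to that product. *)
Lemma zeta_euler_le (R : realType) (l : R) (P : seq nat) : 0 < l ->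
  uniq P -> all prime P -> \prod_(p <- P) (1 + zeta_term R l p) <= 1 + l.
Proof.
move=> l0 uP aP.
have P0 (Q : seq nat) : all prime Q -> (0 < \prod_(p <- Q) p)%N.
  move=> /allP aQ; rewrite big_seq prodn_cond_gt0 // => p /aQ; exact: prime_gt0.
have sf0 Q n : all prime Q -> n \in squarefree_products Q -> (0 < n)%N.
  by move=> /P0 Q0 /squarefree_products_dvd /dvdn_gt0; exact.
have -> : \prod_(p <- P) (1 + zeta_term R l p)
    = \sum_(n <- squarefree_products P) zeta_term R l n.
  elim: P {uP} aP => [|p P IH] /=; first by rewrite big_nil big_seq1 zeta_term1.
  move=> /andP[pp aP]; rewrite big_cons big_cat big_map /= IH // mulrDl mul1r.
  congr (_ + _); rewrite mulr_sumr !big_seq; apply: eq_bigr => n nP.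
  by rewrite zeta_termM ?(prime_gt0 pp) ?(sf0 P).
apply: (le_trans _ (zeta_sum_le R l (\prod_(p <- P) p)%N l0)).
apply: ler_sum_subseq_pos; [exact: squarefree_products_uniq|exact: iota_uniq| |].
  move=> n nP; rewrite mem_iota (sf0 P) //= add1n ltnS dvdn_leq ?P0 //.
  exact: squarefree_products_dvd.
by move=> n _; exact: expR_ge0.
Qed.

(* Rankin's trick: at s = 1 + 1/l the Euler product is at most 1 + l, and moving
   from s to 1 costs (1/l) * sum (ln p)/p <= 2. *)
Lemma mertens_upper (R : realType) (l : R) (N : nat) :
  (0 < N)%N -> 1 <= l -> ln N%:R <= l ->
  recip_sum R (primes_upto N) <= ln l + 4.
Proof.
move=> N0 l1 Nl; have l0 : 0 < l by lra.
set P := primes_upto N.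
have P2 p : p \in P -> (2 <= p)%N.
  by rewrite mem_primes_upto => /andP[/prime_gt1].
have := zeta_euler_le R l P l0 (primes_upto_uniq N) (primes_upto_prime N).
have small p : p \in P -> 0 <= zeta_term R l p <= p%:R^-1.
  move=> /P2 p2; rewrite expR_ge0 zeta_termE ?(ltnW p2) //=.
  rewrite ler_piMr ?invr_ge0 // -[leRHS]expR0 ler_expR oppr_le0.
  by rewrite mulr_ge0 ?invr_ge0 ?(ltW l0) // ln_ge0 // ler1n ltnW.
have s1 := sum_inv_sq_le1 R P (primes_upto_uniq N) (introT allP P2).
have s2 := sum_ln_div_prime_le R N N0.
(* Here 3 is 2 for moving from s to 1, plus 1 for the sum of 1/p^2. The fourth unit of the final
   bound comes from 1 + l <= e l. *)
have lower : expR (recip_sum R P - 3) <= \prod_(p <- P) (1 + zeta_term R l p).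
  apply: (@le_trans _ _
    (\prod_(p <- P) expR (zeta_term R l p - zeta_term R l p ^+ 2))); last first.
    rewrite !big_seq; apply: ler_prod => p /[dup] /P2 p2 /small /andP[z0 z1].
    rewrite expR_ge0; apply: expR_le_1add; rewrite z0 (le_trans z1) //.
    by rewrite invf_le1 ?ler1n ?ltr0n ltnW.
  rewrite -expR_sum ler_expR.
  apply: (@le_trans _ _ (\sum_(p <- P)
     (p%:R^-1 - l^-1 * (ln p%:R / p%:R) - ((p%:R : R)^-1) ^+ 2))).
    rewrite !big_split /= !sumrN -mulr_sumr /recip_sum.
    have : l^-1 * \sum_(p <- P) ln (p%:R : R) / p%:R <= 2.
      by rewrite mulrC ler_pdivrMr // (le_trans s2) // ler_pM2l.
    by lra.
  rewrite !big_seq; apply: ler_sum => p /[dup] /P2 p2 /small /andP[z0 z1].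
  apply: lerB; last by rewrite lerXn2r ?nnegrE ?invr_ge0.
  rewrite zeta_termE ?(ltnW p2) //.
  have -> : p%:R^-1 - l^-1 * (ln p%:R / p%:R)
     = (p%:R : R)^-1 * (1 + - (l^-1 * ln p%:R)) by ring.
  by rewrite ler_wpM2l ?invr_ge0 // expR_ge1Dx.
move=> /(le_trans lower) h.
have h2 : expR (recip_sum R P - 3) <= expR (ln l + 1).
  apply: (le_trans h); rewrite expRD lnK ?posrE //.
  have := expR_ge1Dx (1 : R); nra.
by move: h2; rewrite ler_expR; lra.
Qed.

(** * Bounds for the Dickman function *)

Section dickman.
Variables (R : realType) (rho : R -> R).
Hypothesis hrho : is_dickman_rho rho.

Let cont_within (a b : R) : 0 <= a -> {within `[a, b], continuous rho}%classic.
Proof.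
move=> a0; have [+ _] := hrho; apply: continuous_subspaceW => x /=.
by rewrite in_itv /= => /andP[ax _]; exact: le_trans ax.
Qed.

(** Continuity of [rho] is given only on the half-line. The even extension is continuous everywhere,
    and integrating it from -1 makes 0 an interior point, so the primitive has a two-sided
    derivative there too. *)
Lemma dickman_primitive :
  exists G : R -> R, forall x : R, 0 <= x -> is_derive x 1 G (rho x).
Proof.
pose r (x : R) := rho `|x|.
have cr : continuous r.
  have [/subspace_continuousP h _] := hrho.
  move=> x; apply: (cvg_comp _ _ _ (h `|x| (normr_ge0 x))).
  move=> A /=; rewrite /within /= => hA.
  have := @norm_continuous R R x _ hA.
  by rewrite !nbhs_filterE /=; apply: filterS => y /=; apply; exact: normr_ge0.
exists (fun x => \int[lebesgue_measure]_(t in `[(-1 : R), x]%classic) r t)%R.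
move=> x x0.
have xu : x < x + 1 by rewrite ltrDl.
have ax : -1 < x by apply: lt_le_trans x0.
have ir : (@lebesgue_measure R).-integrable `[(-1 : R), x + 1]%classic (EFin \o r).
  apply: continuous_compact_integrable; first exact: segment_compact.
  by apply: continuous_subspaceT.
have [d e] := @continuous_FTC1_closed R r (-1) x (x + 1) xu ir ax (cr x).
have -> : rho x = r x by rewrite /r ger0_norm.
rewrite -e derive1E; exact: derivableP.
Qed.

(* u rho(u) and the integral of rho over [u-1, u] have the same derivative and
   agree at u = 1; c comes from the mean value theorem for that integral. *)
Lemma dickman_mean (u : R) : 1 <= u ->
  exists2 c, c \in `]u - 1, u[ & u * rho u = rho c.
Proof.
have [G dG] := dickman_primitive; have [_ [r1 dr]] := hrho.
have cG (a b : R) : 0 <= a -> {within `[a, b], continuous G}%classic.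
  move=> a0; apply: continuous_in_subspaceT => x.
  rewrite inE /= in_itv /= => /andP[ax _].
  have := dG x (le_trans a0 ax) => -[d _].
  by apply: differentiable_continuous; apply/derivable1_diffP.
move=> u1.
have mvt (a b : R) : 0 <= a -> a < b ->
    exists2 c, c \in `]a, b[ & G b - G a = rho c * (b - a).
  move=> a0 ab; apply: MVT => //; last exact: cG.
  move=> x; rewrite in_itv /= => /andP[ax _]; apply: dG.
  exact: ltW (le_lt_trans a0 ax).
suff e : u * rho u = G u - G (u - 1).
  have [||c cu ec] := mvt (u - 1) u; [lra|lra|exists c => //].
  by rewrite e ec opprB addrC subrK mulr1.
pose H x := x * rho x - G x + G (x - 1).
have dH (x : R) : x \in `]1, u[ -> is_derive x 1 H ((fun=> 0) x).
  rewrite in_itv /= => /andP[x1 _].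
  have d1 := dr x x1.
  have d2 : is_derive x 1 G (rho x) by apply: dG; lra.
  have d3 : is_derive (x - 1) 1 G (rho (x - 1)) by apply: dG; lra.
  rewrite /H.
  have d4 : is_derive x 1 (fun y => G (y - 1)) (rho (x - 1)).
    have d5 : is_derive x 1 (fun y : R => y - 1) 1.
      by apply: is_derive_eq; rewrite subr0.
    by have := @is_derive1_comp R G (fun y => y - 1) x _ _ d3 d5; rewrite mulr1.
  apply: is_derive_eq.
  rewrite /GRing.scale /= mulr1 mulrCA divff; lra.
have [|c _] := @MVT_segment R H (fun=> 0) 1 u u1 dH.
  move=> x; apply: cvgD; first apply: cvgB; first apply: cvgM.
  - exact: (@continuous_subspaceT _ _ `[1, u]%classic idfun (fun y => cvg_id) x).
  - exact: (cont_within 1 u ler01 x).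
  - exact: (cG 1 u ler01 x).
  - have cG1 : {within `[1, u], continuous (fun y => G (y - 1))}%classic.
      apply: continuous_in_subspaceT => y.
      rewrite inE /= in_itv /= => /andP[y1 _].
      apply: (@cvg_comp _ _ _ (fun y : R => y - 1) G _ (nbhs (y - 1))).
        by apply: cvgB; [exact: cvg_id|exact: cvg_cst].
      have y0 : 0 <= y - 1 by rewrite subr_ge0.
      have [/derivable1_diffP/differentiable_continuous d _] := dG _ y0.
      exact: d.
    exact: cG1 x.

rewrite mul0r /H subrr => /eqP; rewrite subr_eq0 => /eqP e.
(* The value of the constant [H] at 1: since [rho] is 1 on [0, 1], also [G 1 - G 0] is 1. *)
have [||c0 c01 ec] := mvt 0 1; [lra|lra|].
have rc : rho c0 = 1.
  by apply: r1; move: c01; rewrite in_itv /= => /andP[a b]; rewrite !ltW.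
have := r1 1; rewrite lexx ler01 => /(_ isT) e1.
by move: e ec; rewrite rc e1; lra.
Qed.

Lemma dickman_slope (a b : R) : 1 <= a -> a < b ->
  exists2 c, c \in `]a, b[ & rho b - rho a = - (rho (c - 1)) / c * (b - a).
Proof.
move=> a1 ab; have [_ [_ dr]] := hrho.
apply: (@MVT R rho (fun c => - (rho (c - 1)) / c)) => //.
  by move=> x; rewrite in_itv /= => /andP[ax _]; apply: dr; exact: le_lt_trans ax.
by apply: cont_within; lra.
Qed.

(** Induction over unit intervals. If rho(u) <= 0 with u > 1, the mean value point c has rho(c) = u
    rho(u) <= rho(u). But c lies in the new interval, and positivity one unit earlier makes rho
    strictly decrease from c to u, a contradiction. *)
Lemma dickman_gt0 (u : R) : 0 <= u -> 0 < rho u.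
Proof.
have [_ [r1 _]] := hrho.
suff h n : forall u : R, 0 <= u <= n.+1%:R -> 0 < rho u.
  move=> u0; apply: (h (Num.truncn u)); rewrite u0 /=.
  exact/ltW/truncnS_gt.
elim: n => [|n IH] {}u; first by move=> /r1 ->.
move=> /andP[u0 un].
have [un'|nu] := leP u n.+1%:R; first by apply: IH; rewrite u0 un'.
have n1 : (1 : R) <= n.+1%:R by rewrite ler1n.
have u1 : 1 < u by apply: le_lt_trans nu.
rewrite ltNge; apply/negP => ru.
have [c] := dickman_mean u (ltW u1).
rewrite in_itv /= => /andP[c1 cu] e.
have rc : rho c <= 0 by rewrite -e mulr_ge0_le0.
have nc : n.+1%:R < c.
  rewrite ltNge; apply/negP => cn.
  by have := IH c; rewrite cn andbT ltNge rc => /(_ _)/negP; case=> //; lra.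
have [] := dickman_slope c u; [lra|exact: cu|].
move=> d; rewrite in_itv /= => /andP[cd du] es.
have d0 : 0 < d by lra.
have rd : 0 < rho (d - 1).
  apply: IH; rewrite subr_ge0 (le_trans n1) /=; last by lra.
  by rewrite lerBlDr natr1 (le_trans (ltW du)).
have : rho u < rho c.
  rewrite -subr_lt0 es mulNr mulNr oppr_lt0 mulr_gt0 ?subr_gt0 //.
  by rewrite divr_gt0.
nra.
Qed.

Lemma dickman_nincr (a b : R) : 0 <= a -> a <= b -> rho b <= rho a.
Proof.
have [_ [r1 _]] := hrho.
have big (x y : R) : 1 <= x -> x <= y -> rho y <= rho x.
  move=> x1; rewrite le_eqVlt => /orP[/eqP -> //|xy].
  have [c] := dickman_slope x y x1 xy; rewrite in_itv /= => /andP[xc cy] e.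
  have c1 : 0 < rho (c - 1) by apply: dickman_gt0; lra.
  rewrite -subr_le0 e !mulNr oppr_le0 mulr_ge0 ?subr_ge0 ?(ltW xy) //.
  by rewrite divr_ge0 ?(ltW c1) //; lra.
move=> a0 ab; have [a1|/ltW a1] := leP 1 a; first exact: big.
rewrite [rho a]r1 ?a0 //; have [b1|/ltW b1] := leP b 1.
  by rewrite r1 // b1 (le_trans a0).
by rewrite -(r1 1) ?ler01 ?lexx //; apply: big.
Qed.

(** Monotonicity turns the mean value identity into u rho(u) <= rho(u - 1), which is iterated n
    times. *)
Lemma dickman_le_inv_fact (n : nat) (u : R) : n%:R <= u -> rho u <= (n`!%:R)^-1.
Proof.
have [_ [r1 _]] := hrho.
elim: n u => [|n IH] u nu.
  by rewrite fact0 invr1 -(r1 0) ?lexx ?ler01 //; exact: dickman_nincr.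
have n1 : (1 : R) <= n.+1%:R by rewrite ler1n.
have u1 : 1 <= u by apply: le_trans nu.
have [c] := dickman_mean u u1; rewrite in_itv /= => /andP[c1 cu] e.
have h1 : u * rho u <= rho (u - 1).
  by rewrite e dickman_nincr ?subr_ge0 // ltW.
have h2 : rho (u - 1) <= (n`!%:R)^-1 by apply: IH; rewrite lerBrDr natr1.
have r0 : 0 < rho u by apply: dickman_gt0; lra.
rewrite factS natrM invfM mulrC ler_pdivlMr ?ltr0n // mulrC.
by apply: le_trans h2; apply: le_trans h1; rewrite ler_pM2r.
Qed.

End dickman.

(** * Integers composed of primes where f = 1 *)

Lemma filter_primes_upto_uniq (N : nat) (P : pred nat) :
  uniq [seq p <- primes_upto N | P p].
Proof. exact/filter_uniq/primes_upto_uniq. Qed.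

Lemma sum_inv_primes_uptoE (R : realType) (N : nat) (P : nat -> bool) :
  \sum_(p < N.+1 | prime p && P p) ((p%:R : R))^-1
    = recip_sum R [seq p <- primes_upto N | P p].
Proof.
rewrite -(big_mkord (fun p => prime p && P p) (fun p => (p%:R : R)^-1)).
rewrite /recip_sum -filter_predI big_filter /index_iota subn0 /= big_cons /=.
by apply: eq_bigl => p; rewrite /= andbC.
Qed.

Lemma completely_mult_eq1 (f : nat -> algC) : completely_mult f ->
  forall n, (0 < n)%N -> (forall p, prime p -> (p %| n)%N -> f p = 1) -> f n = 1.
Proof.
move=> [f1 fM] n; have [m] := ubnP n; elim: m n => // m IH n nm n0 fp.
have [n1|n2] := leqP n 1; first by have -> : n = 1%N by lia.
have dv := pdiv_dvd n; have pp := pdiv_prime n2.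
have q0 : (0 < n %/ pdiv n)%N by rewrite divn_gt0 ?(prime_gt0 pp) // pdiv_leq.
have fn : f n = f (n %/ pdiv n)%N * f (pdiv n).
  by rewrite -fM ?(prime_gt0 pp) // divnK.
rewrite fn (fp _ pp dv) mulr1; apply: IH => //.
  by rewrite (leq_trans (ltn_Pdiv (prime_gt1 pp) n0)).
move=> p pr pd; apply: fp => //; apply: dvdn_trans pd _.
by rewrite -[X in (_ %| X)%N](divnK dv) dvdn_mulr.
Qed.

Lemma recip_sum_le_of_count (R : realType) (a : pred nat) (K : R) (m N : nat) :
  (0 < m)%N ->
  (forall n, (m <= n)%N -> (count a (iota 1 n))%:R <= K * n%:R) ->
  recip_sum R [seq n <- iota m.+1 N | a n] <= K * (1 + ln (m + N)%:R).
Proof.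
move=> m0 cK.
have K0 : 0 <= K.
  have := le_trans (ler0n _ _) (cK m (leqnn m)).
  by rewrite pmulr_lge0 // ltr0n.
have step (x c e s r : R) : 0 < x -> r <= c / x + K * s -> c <= K * x ->
    r + e / (x + 1) <= (c + e) / (x + 1) + K * (s + (x + 1)^-1).
  move=> x0 hr hc.
  have h : c / x - c / (x + 1) <= K / (x + 1).
    have -> : c / x - c / (x + 1) = (c / x) / (x + 1) by field; rewrite !gt_eqF //; lra.
    by rewrite ler_wpM2r ?invr_ge0 ?ler_pdivrMr //; lra.
  by rewrite mulrDl mulrDr; lra.
(* Partial summation as an induction on N: passing from x to x + 1 lowers the boundary term c/x by
   at most K/(x + 1), because c <= K x. *)
have : recip_sum R [seq n <- iota m.+1 N | a n]
    <= (count a (iota 1 (m + N)))%:R / (m + N)%:R + K * recip_sum R (iota m.+1 N).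
  elim: N => [|N IH]; first by rewrite /recip_sum /= !big_nil addn0 mulr0 addr0 divr_ge0.
  have -> : recip_sum R [seq n <- iota m.+1 N.+1 | a n]
      = recip_sum R [seq n <- iota m.+1 N | a n] + (a (m + N).+1)%:R / (m + N).+1%:R.
    rewrite -[N.+1]addn1 iotaD filter_cat /recip_sum big_cat /= addSn.
    by case: (a _); rewrite ?big_seq1 ?big_nil ?mul1r ?mul0r.
  have -> : recip_sum R (iota m.+1 N.+1) = recip_sum R (iota m.+1 N) + (m + N).+1%:R^-1.
    by rewrite -[N.+1]addn1 iotaD /recip_sum big_cat /= big_seq1 addSn.
  have -> : count a (iota 1 (m + N.+1)) = (count a (iota 1 (m + N)) + a (m + N).+1)%N.
    by rewrite addnS -[(m + N).+1]addn1 iotaD count_cat /= addn0 add1n addn1.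
  rewrite addnS natrD.
  have cn := cK (m + N)%N (leq_addr _ _).
  have n0 : (0 : R) < (m + N)%:R by rewrite ltr0n addn_gt0 m0.
  have eS : ((m + N).+1%:R : R) = (m + N)%:R + 1 by rewrite natr1.
  by rewrite eS; exact: step.
move=> /le_trans; apply; rewrite mulrDr mulr1 lerD //.
  by rewrite ler_pdivrMr ?ltr0n ?addn_gt0 ?m0 // cK // leq_addr.
rewrite ler_wpM2l // (le_trans (recip_sum_iota_le R m N m0)) // gerBl.
by rewrite ln_ge0 // ler1n.
Qed.

(* In the application B = log(1/eta) + 100, which is where e^107 = e^(100+7) and
   e^102 = e^(100+2) come from; 7 = 1 + 4 + 2 absorbs the errors in the two
   Mertens bounds. *)
Section good_integers.
Variables (R : realType) (g : pred nat) (B lw : R) (k : nat).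
Hypotheses (B0 : 0 <= B) (lw1 : 1 <= lw).
Let ly : R := lw * expR (B + 7).
Let W := Num.truncn (expR lw).
Let Y := Num.truncn (expR ly).
Hypothesis bad_le : recip_sum R [seq p <- primes_upto Y | ~~ g p] <= B.

Let lwy : lw <= ly.
Proof. rewrite ler_peMr ?(le_trans ler01 lw1) // -[leLHS]expR0 ler_expR. by have := B0; lra. Qed.

Let WY : (W <= Y)%N.
Proof. by apply: le_truncn; rewrite ler_expR. Qed.

Let W_itv : (W%:R : R) <= expR lw < W.+1%:R.
Proof. by apply: truncn_itv; exact: expR_ge0. Qed.

Let Y_itv : (Y%:R : R) <= expR ly < Y.+1%:R.
Proof. by apply: truncn_itv; exact: expR_ge0. Qed.

Let W0 : (0 < W)%N.
Proof.
rewrite -ltnS -(ltr_nat R); apply: le_lt_trans (proj2 (andP W_itv)).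
by have := expR_ge1Dx lw; have := lw1; lra.
Qed.

Let bigs := [seq p <- primes_upto Y | (W < p)%N && g p].

Let bigs_mass : 1 <= recip_sum R bigs.
Proof.
have lw0 : 0 < lw by exact: lt_le_trans lw1.
have ly0 : 0 < ly by apply: lt_le_trans lwy.
have lower : ln ly <= recip_sum R (primes_upto Y) + 2.
  rewrite -ler_expR lnK ?posrE //; apply: le_trans (mertens_lower R Y).
  rewrite -[leLHS]expRK ler_ln ?posrE ?expR_gt0 ?ltr0n //.
  by apply: ltW; case/andP: Y_itv.
have upper : recip_sum R (primes_upto W) <= ln lw + 4.
  apply: mertens_upper => //; rewrite -[leRHS]expRK ler_ln ?posrE ?expR_gt0 ?ltr0n //.
  by case/andP: W_itv.
have lnly : ln ly = ln lw + (B + 7) by rewrite lnM ?posrE ?expR_gt0 // expRK.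
(* Every prime up to Y is at most W, or violates [g], or lies in [bigs]. *)
have split : recip_sum R (primes_upto Y) <=
    recip_sum R (primes_upto W) + recip_sum R [seq p <- primes_upto Y | ~~ g p]
      + recip_sum R bigs.
  have -> : recip_sum R (primes_upto Y)
     = recip_sum R [seq p <- primes_upto Y | ~~ ((W < p)%N && g p)] + recip_sum R bigs.
    by rewrite /recip_sum (bigID (fun p => (W < p)%N && g p)) /= addrC !big_filter.
  rewrite lerD2r.
  have -> : recip_sum R [seq p <- primes_upto Y | ~~ ((W < p)%N && g p)]
     = recip_sum R [seq p <- primes_upto Y | (p <= W)%N]
       + recip_sum R [seq p <- primes_upto Y | (W < p)%N && ~~ g p].
    rewrite /recip_sum !big_filter (bigID (fun p => (p <= W)%N)) /=.
    congr (_ + _); apply: eq_bigl => p; rewrite ltnNge.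
      by case: (p <= W)%N; rewrite ?andbF.
    by case: (p <= W)%N; rewrite ?andbF ?andbT.
  apply: lerD; apply: recip_sum_le; rewrite ?filter_primes_upto_uniq ?primes_upto_uniq //.
    by move=> p; rewrite mem_filter !mem_primes_upto => /and3P[-> ->].
  by move=> p; rewrite !mem_filter => /andP[/andP[_ ->]].
by move: lower upper split bad_le; rewrite lnly; lra.
Qed.

Let smalls := [seq n <- iota 1 W | free_of [seq p <- primes_upto W | ~~ g p] n].

(** Only the bad primes up to W are sieved out; their reciprocal sum is at most B, so the sieve
    keeps a proportion e^(-(B+2)) of a harmonic sum of size at least [lw]. *)
Let smalls_mass : expR (- (B + 2)) * lw <= recip_sum R smalls.
Proof.
set Q := [seq p <- primes_upto W | ~~ g p].
have uQ : uniq Q by rewrite filter_uniq ?primes_upto_uniq.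
have pQ : all prime Q.
  by apply/allP => p; rewrite mem_filter => /andP[_]; rewrite mem_primes_upto => /andP[].
have QB : recip_sum R Q <= B.
  apply: le_trans bad_le; apply: recip_sum_le; rewrite ?filter_primes_upto_uniq ?primes_upto_uniq //.
  move=> p; rewrite !(mem_primes_upto, mem_filter) => /and3P[-> -> pW].
  exact: leq_trans pW WY.
have Q1 : all (leq 1) Q by apply: sub_all pQ => p /prime_gt0.
apply: le_trans (sieve_recip_sum R Q W Q1); apply: ler_pM.
- exact: expR_ge0.
- exact: le_trans lw1.
- apply: le_trans (prod_1sub_ge R Q uQ pQ).
  by rewrite ler_expR lerN2 lerD2r.
- apply: le_trans (recip_sum_iota_ge R W).
  rewrite -[leLHS]expRK ler_ln ?posrE ?expR_gt0 ?ltr0n //.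
  by apply: ltW; case/andP: W_itv.
Qed.

(** E consists of the products of k primes from [bigs] and one element of [smalls]. The primes in
    [bigs] exceed W, so none divides an element of [smalls], and their reciprocal sum is at least 1,
    so its k-th power loses nothing. *)
Lemma many_good_integers : exists E : seq nat,
  [/\ uniq E,
      forall n, n \in E -> (0 < n)%N /\ (forall p, prime p -> (p %| n)%N -> g p),
      forall n, n \in E -> expR (k%:R * lw) <= n%:R <= expR (lw + k%:R * ly) &
      expR (- (B + 2)) * lw <= k`!%:R * recip_sum R E].
Proof.
have bigsP p : p \in bigs -> [/\ prime p, (W < p)%N, (p <= Y)%N & g p].
  by rewrite mem_filter mem_primes_upto => /andP[/andP[? ?] /andP[? ?]].
have smallsP n : n \in smalls -> [/\ (0 < n)%N, (n <= W)%N &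
    forall p, prime p -> (p %| n)%N -> g p].
  rewrite mem_filter mem_iota add1n ltnS => /andP[/allP fn /andP[n0 nW]].
  split=> // p pp pn; apply: contraT => gp.
  have /fn : p \in [seq p <- primes_upto W | ~~ g p].
    by rewrite mem_filter gp mem_primes_upto pp (leq_trans _ nW) // dvdn_leq.
  by rewrite pn.
have us : uniq smalls by rewrite filter_uniq ?iota_uniq.
have ub : uniq bigs by rewrite filter_uniq ?primes_upto_uniq.
exists (prime_products bigs smalls k); split.
- exact: prime_products_uniq.
- apply: (prime_products_ind bigs smalls
    (fun _ n => (0 < n)%N /\ forall p, prime p -> (p %| n)%N -> g p)).
    by move=> n /smallsP[].
  move=> _ q n /bigsP[pq _ _ gq] [n0 gn]; split; first by rewrite muln_gt0 prime_gt0.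
  move=> p pp; rewrite Euclid_dvdM // => /orP[|]; last exact: gn.
  by rewrite dvdn_prime2 // => /eqP ->.
- apply: (prime_products_ind bigs smalls
    (fun j n => expR (j%:R * lw) <= n%:R <= expR (lw + j%:R * ly))).
    move=> n /smallsP[n0 nW _]; rewrite !mul0r expR0 addr0 ler1n n0 /=.
    by case/andP: W_itv => + _; apply: le_trans; rewrite ler_nat.
  move=> j q n /bigsP[pq Wq qY _] /andP[nl nu]; rewrite natrM; apply/andP; split.
    rewrite -natr1 mulrDl mul1r addrC expRD ler_pM ?expR_ge0 //.
    by case/andP: W_itv => _ /ltW /le_trans; apply; rewrite ler_nat.
  rewrite -natr1 mulrDl mul1r addrA [_ + ly]addrC expRD ler_pM //.
  by case/andP: Y_itv => + _; apply: le_trans; rewrite ler_nat.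
- apply: (le_trans smalls_mass).
  apply: le_trans (prime_products_mass R bigs smalls k ub _ us _).
  + by rewrite ler_peMl ?recip_sum_ge0 // exprn_ege1.
  + by apply/allP => p /bigsP[].
  + move=> n /smallsP[n0 nW _]; apply/eqP; rewrite -leqn0 leqNgt -has_count.
    apply/hasPn => p /bigsP[_ Wp _ _]; apply/negP => /(dvdn_leq n0) pn.
    by move: (leq_trans Wp (leq_trans pn nW)); rewrite ltnn.
Qed.

End good_integers.

(** * An upper bound for d from the class condition at the value 1 *)

Lemma prod_zero_primes_le1 (R : realType) (x : R) (f : nat -> algC) :
  prod_zero_primes_upto x f <= 1.
Proof.
rewrite /prod_zero_primes_upto; apply: prodr_ile1 => p /andP[pp _].
by rewrite subr_ge0 invf_le1 ?ltr0n ?ler1n ?prime_gt0 //= gerBl invr_ge0.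
Qed.

Lemma classM_count (R : realType) (x0 : R) (d : nat) (f : nat -> algC) (n : nat) :
  0 <= x0 -> classM x0 d f -> x0 <= n%:R ->
  (count (fun n => f n == 1) (iota 1 n))%:R <= 100 / d%:R * n%:R :> R.
Proof.
move=> x00 [_ [_ h]] nx.
have := h n%:R nx 1 (expr1n _ _); rewrite /count_upto natrK => /le_trans; apply.
have -> : 100 / d%:R * n%:R = 100 * n%:R / d%:R :> R by ring.
by rewrite ler_piMr ?prod_zero_primes_le1 // divr_ge0 // mulr_ge0.
Qed.

(** Two estimates for the reciprocal sum of the good integers are compared: the sieve lower bound
    and partial summation of the class condition. Here [lw] is log w, and the last hypothesis says
    w^k >= x0^2. *)
Lemma classM1_order_le (R : realType) (x0 eta delta x : R) (d k : nat)
    (f : nat -> algC) :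
  2 <= x0 -> 0 < eta < 1 -> (0 < d)%N -> classM1 x0 d f ->
  powR x0 delta < x ->
  sum_inv_primes_upto x (fun p => (f p != 0) && (f p != 1)) <= ln eta^-1 ->
  1 <= eta * delta * ln x0 / expR 107 ->
  2 * ln x0 <= k%:R * (eta * delta * ln x0 / expR 107) ->
  d%:R <= 100 * expR 102 * k`!%:R / eta * (1 + k.+1%:R * expR 107 / eta).
Proof.
move=> x02 /andP[eta0 eta1] d0 [cM zero_le] xy bad_lt; set lw := _ / expR 107 => lw1 klw.
have x00 : 0 < x0 by lra.
have ieta : 1 <= eta^-1 by rewrite invf_ge1 // ltW.
have lneta : 0 <= ln eta^-1 by rewrite ln_ge0.
pose B := ln eta^-1 + 100.
have B0 : 0 <= B by rewrite /B; lra.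
pose ly := lw * expR (B + 7).
have expB : expR (B + 7) = expR 107 / eta.
  have -> : B + 7 = 107 + ln eta^-1 by rewrite /B; lra.
  by rewrite expRD lnK // posrE invr_gt0.
have lyE : ly = delta * ln x0.
  rewrite /ly expB /lw; field.
  by rewrite !gt_eqF ?expR_gt0.
have bad : recip_sum R
    [seq p <- primes_upto (Num.truncn (expR ly)) | ~~ (f p == 1)] <= B.
  set N := Num.truncn (expR ly).
  have Nx : (N <= Num.truncn x)%N.
    apply: le_truncn; apply: le_trans (ltW xy).
    by rewrite lyE /powR gt_eqF.
  have -> : recip_sum R [seq p <- primes_upto N | ~~ (f p == 1)]
     = recip_sum R [seq p <- primes_upto N | (f p != 0) && (f p != 1)]
       + recip_sum R [seq p <- primes_upto N | f p == 0].
    rewrite /recip_sum !big_filter (bigID (fun p => f p != 0)) /=.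
    congr (_ + _); apply: eq_bigl => p; first by rewrite andbC.
    by rewrite negbK andb_idl // => /eqP ->; rewrite eq_sym oner_eq0.
  apply: lerD.
    apply: le_trans bad_lt; rewrite /sum_inv_primes_upto.
    rewrite (sum_inv_primes_uptoE R _ (fun p => (f p != 0) && (f p != 1))).
    apply: recip_sum_le; rewrite ?filter_primes_upto_uniq ?primes_upto_uniq //.
    move=> p; rewrite !(mem_primes_upto, mem_filter) => /and3P[-> -> pN].
    exact: leq_trans pN Nx.
  by have := zero_le N.+1; rewrite (sum_inv_primes_uptoE R _ (fun p => f p == 0)).
have [E [uE Eg Eb Em]] := many_good_integers R (fun p => f p == 1) B lw k B0 lw1 bad.
(* From [m] on the class condition applies, and m + 1 <= x0 + 2 <= x0^2 for x0 >= 2 places all of E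
   beyond [m]. *)
pose m := (Num.truncn x0).+1.
pose N := Num.truncn (expR (lw + k%:R * ly)).
have /andP[tx _] := truncn_itv (ltW x00).
have xm : x0 <= m%:R by apply/ltW/truncnS_gt.
have kx : x0 * x0 <= expR (k%:R * lw).
  rewrite -[x0 * x0]lnK ?posrE ?mulr_gt0 // ler_expR lnM ?posrE //; lra.
have mk : m.+1%:R <= expR (k%:R * lw).
  by apply: le_trans kx; rewrite -!natr1; nra.
have Esub : {subset E <= [seq n <- iota m.+1 (N - m) | f n == 1]}.
  move=> n nE; have [n0 gn] := Eg n nE; have /andP[nl nu] := Eb n nE.
  have mn : (m < n)%N by rewrite -(ler_nat R) (le_trans mk).
  have nN : (n <= N)%N by rewrite /N truncn_ge_nat ?expR_ge0.
  rewrite mem_filter mem_iota mn /= addSn ltnS subnKC ?nN ?andbT.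
    apply/eqP; apply: completely_mult_eq1 => //; first by case: cM.
    by move=> p pp pn; apply/eqP; exact: gn.
  exact: ltnW (leq_trans mn nN).
(* The subtraction is truncated, so the argument is the maximum of m and N; both are treated. *)
have lnmN : ln (m + (N - m))%:R <= k.+1%:R * ly.
  have lw0 : 0 < lw by lra.
  have lwy : lw <= ly.
    rewrite /ly ler_peMr ?(ltW lw0) // -[leLHS]expR0 ler_expR; lra.
  have k0 : 0 <= k%:R :> R by [].
  rewrite -[leRHS]expRK ler_ln ?posrE ?expR_gt0 ?ltr0n ?addSn //.
  rewrite -addSn -/m -maxnE /maxn; case: ifP => _.
    apply: (@le_trans _ _ (expR (lw + k%:R * ly))).
      by rewrite /N; have /andP[] := truncn_itv (expR_ge0 (lw + k%:R * ly)).
    by rewrite ler_expR -natr1 mulrDl mul1r addrC lerD2l.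
  apply: (@le_trans _ _ (expR (k%:R * lw))).
    by apply: le_trans mk; rewrite ler_nat.
  by rewrite ler_expR -natr1 mulrDl mul1r; nra.
have Eup : recip_sum R E <= 100 / d%:R * (1 + k.+1%:R * ly).
  apply: (@le_trans _ _ (recip_sum R [seq n <- iota m.+1 (N - m) | f n == 1])).
    by apply: recip_sum_le; rewrite ?filter_uniq ?iota_uniq.
  apply: (@le_trans _ _ (100 / d%:R * (1 + ln (m + (N - m))%:R))).
    apply: (recip_sum_le_of_count R (fun n => f n == 1)) => // n mn.
    by apply: (classM_count R x0) => //; rewrite ?(ltW x00) // (le_trans xm) ?ler_nat.
  by rewrite ler_wpM2l ?divr_ge0 // lerD2l.
have dR : 0 < d%:R :> R by rewrite ltr0n.
have lw0 : 0 < lw by exact: lt_le_trans lw1.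
have Bexp : expR (- (B + 2)) = eta / expR 102.
  have -> : - (B + 2) = ln eta - 102 by rewrite /B lnV ?posrE //; lra.
  by rewrite expRD expRN lnK ?posrE.
have e102 : 0 < expR 102 :> R by exact: expR_gt0.
have e107 : 0 < expR 107 :> R by exact: expR_gt0.
(* The summand 1 in [Eup] is replaced by [lw], so that [lw] can be cancelled from both sides. *)
have main : eta / expR 102 * lw
    <= k`!%:R * (100 / d%:R * (lw * (1 + k.+1%:R * expR 107 / eta))).
  rewrite -Bexp; apply: (le_trans Em); rewrite ler_wpM2l //.
  apply: (le_trans Eup); rewrite ler_wpM2l ?divr_ge0 // mulrDr mulr1 lerD //.
  by rewrite /ly expB le_eqVlt; apply/orP; left; apply/eqP; ring.
have v0 : 0 <= d%:R * (expR 102 / eta / lw) :> R.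
  by apply: mulr_ge0 => //; apply: divr_ge0; [apply: divr_ge0|]; exact: ltW.
have := ler_wpM2r v0 main.
have -> : eta / expR 102 * lw * (d%:R * (expR 102 / eta / lw)) = d%:R :> R.
  by field; rewrite !gt_eqF.
move/le_trans; apply; rewrite le_eqVlt; apply/orP; left; apply/eqP.
move: (k.+1%:R) (k`!%:R) (expR 102) (expR 107) e102 e107 => K F a b a0 b0.
by field; rewrite !gt_eqF.
Qed.

(** * Comparison with the Dickman function and choice of constants *)

Lemma fact_ge_expn2 (n : nat) : (2 ^ n <= n.+1`!)%N.
Proof.
elim: n => // n IH; rewrite expnS factS leq_mul //.
Qed.

Lemma expn3_fact_le (n : nat) : (n.+1 ^ 3 * n`! <= n.+3`!)%N.
Proof.
rewrite 3!factS !mulnA leq_mul2r; apply/orP; right.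
by rewrite !expnS expn0; nia.
Qed.

(* The upper bound on d, resp. the hypotheses on q, only serve to make
   ln w = eta * delta * ln x0 / e^107 large; that is automatic because the value
   1 = f 1 is taken up to x0, so that d <= 100 x0. *)
Lemma classM1_sum_ge (R : realType) (rho : R -> R) (hrho : is_dickman_rho rho)
    (x0 eta delta x : R) (d : nat) (f : nat -> algC) :
  2 <= x0 -> 0 < eta < 1 -> 0 < delta < 1 -> classM1 x0 d f ->
  (100 * expR 102 * (1 + expR 107) + 1)
    / rho ((2 * expR 107 + 6) / (eta * delta)) <= d%:R ->
  powR x0 delta < x ->
  ln eta^-1 <= sum_inv_primes_upto x (fun p => (f p != 0) && (f p != 1)).
Proof.
move=> x02 /[dup] eta01 /andP[eta0 eta1] /andP[delta0 delta1] hf.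
set b := expR 107; set a := expR 102; set C1 := _ + 1; set C2 := 2 * b + 6.
have b1 : 1 <= b by have := @expR_ge1Dx R 107; rewrite -/b; lra.
have a1 : 1 <= a by have := @expR_ge1Dx R 102; rewrite -/a; lra.
have C1_100 : 100 <= C1 by rewrite /C1; nra.
pose t := (eta * delta)^-1.
have ed0 : 0 < eta * delta by exact: mulr_gt0.
have t0 : 0 < t by rewrite invr_gt0.
have te : eta^-1 <= t by rewrite lef_pV2 ?posrE // ler_piMr // ltW.
have ie1 : 1 < eta^-1 by rewrite invf_gt1.
have t1 : 1 < t by exact: lt_le_trans te.
have x00 : 0 < x0 by lra.
rewrite -/t => hd xy; rewrite leNgt; apply/negP => /ltW bad.
pose n := Num.truncn (C2 * t).
have C2t : 0 <= C2 * t by rewrite mulr_ge0 ?(ltW t0) // /C2; lra.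
have /andP[n_le n_gt] := truncn_itv C2t; rewrite -/n in n_le n_gt.
have rho0 := dickman_gt0 R rho hrho _ C2t.
have dn : C1 * n`!%:R <= d%:R.
  apply: le_trans hd; rewrite ler_wpM2l //; first by lra.
  rewrite -[leLHS]invrK lef_pV2 ?posrE ?invr_gt0 ?ltr0n ?fact_gt0 //.
  exact: dickman_le_inv_fact.
have d0 : (0 < d)%N.
  rewrite -(ltr0n R); apply: lt_le_trans dn; rewrite mulr_gt0 ?ltr0n ?fact_gt0 //.
  by lra.
have nx : n`!%:R <= x0.
  have [[[f1 _] [_ hc]] _] := hf.
  have h := hc x0 (lexx _) 1 (expr1n _ _).
  have tr1 : (0 < Num.truncn x0)%N by rewrite truncn_gt0; lra.
  have c1 : 1 <= (count_upto x0 f 1)%:R :> R.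
    rewrite ler1n /count_upto; case: (Num.truncn x0) tr1 => // i _ /=.
    by rewrite f1 eqxx.
  have dR : 0 < d%:R :> R by rewrite ltr0n.
  have : 1 <= 100 * x0 / d%:R.
    apply: (le_trans c1); apply: (le_trans h).
    by rewrite ler_piMr ?prod_zero_primes_le1 // divr_ge0 // mulr_ge0 // ltW.
  rewrite ler_pdivlMr // mul1r => dx.
  have : 100 * n`!%:R <= 100 * x0.
    by apply: le_trans dx; apply: le_trans dn; rewrite ler_wpM2r.
  by rewrite ler_pM2l.
(* Since x0 >= n! >= 2^(n-1), ln 2 >= 1/2 and n > C2 t - 1, ln x0 is at least (C2 t - 2)/2 = b t + 3
   t - 1. *)
have lnx : b * t <= ln x0.
  have n0 : (0 < n)%N by rewrite truncn_gt0; rewrite /C2; nra.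
  have l2 : 1 / 2 <= ln 2 :> R by have := lnS_ge R 1 isT; rewrite ln1; lra.
  have : n.-1%:R * ln 2 <= ln x0.
    rewrite mulr_natl -lnXn // ler_ln ?posrE ?exprn_gt0 //; apply: le_trans nx.
    by rewrite -natrX ler_nat -{2}(prednK n0) fact_ge_expn2.
  have np : (n.-1%:R : R) = n%:R - 1 by rewrite -{2}(prednK n0) -natr1 addrK.
  have ng : C2 * t - 1 < n%:R by rewrite ltrBlDr natr1.
  rewrite np => h.
  have h2 : (n%:R - 1) * (1 / 2) <= (n%:R - 1) * ln 2 :> R.
    by rewrite ler_wpM2l // subr_ge0 ler1n.
  move: (n%:R : R) ng h h2 => z ng h h2.
  by move: ng; rewrite /C2 mulrDl => ng; lra.
have lwE : eta * delta * ln x0 / b = ln x0 / (b * t).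
  by rewrite /t; field; rewrite !gt_eqF //; lra.
have bt0 : 0 < b * t by rewrite mulr_gt0 //; lra.
(* As log w = ln x0 / (b t), any k above 2 b t gives w^k >= x0^2. *)
pose k := (Num.truncn (2 * (b * t))).+1.
have k_gt : 2 * (b * t) < k%:R by exact: truncnS_gt.
have k_le : k%:R <= 2 * (b * t) + 1.
  have -> : k%:R = (Num.truncn (2 * (b * t)))%:R + 1 :> R by rewrite natr1.
  have bt2 : 0 <= 2 * (b * t) by lra.
  by rewrite lerD2r; have /andP[] := truncn_itv bt2.
have lnx0 : 0 < ln x0 by exact: lt_le_trans lnx.
have := classM1_order_le R x0 eta delta x d k f x02 eta01 d0 hf xy bad.
rewrite -/a -/b lwE; have lw1 : 1 <= ln x0 / (b * t) by rewrite ler_pdivlMr // mul1r.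
have klw : 2 * ln x0 <= k%:R * (ln x0 / (b * t)).
  by rewrite mulrA ler_pdivlMr // mulrAC ler_pM2r // ltW.
move=> /(_ lw1 klw); apply/negP; rewrite -ltNge; apply: lt_le_trans dn.
(* K dominates both t and 1/eta, so the polynomial factor in the bound for d is at most (1 + b)
   K^3. *)
pose K : R := k.+1%:R.
have KE : K = k%:R + 1 by rewrite /K natr1.
have tK : t <= K by rewrite KE; nra.
have uK : eta^-1 <= K by exact: le_trans tK.
have K0 : 0 < K by exact: lt_le_trans tK.
(* The 6 in [C2] provides this room: k + 3 <= 2 b t + 4 <= C2 t. Then K^3 k! <= (k+3)! <= n! absorbs
   the polynomial factor. *)
have kn : (k.+3 <= n)%N.
  rewrite /n truncn_ge_nat //.
  have -> : k.+3%:R = k%:R + 3 :> R by rewrite -addn3 natrD.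
  by rewrite /C2 mulrDl; lra.
have fk : K ^+ 3 * k`!%:R <= n`!%:R.
  rewrite /K -natrX -natrM ler_nat; apply: (@leq_trans (k.+3)`!); last first.
    exact: leq_fact.
  exact: expn3_fact_le.
have F0 : 0 < k`!%:R :> R by rewrite ltr0n fact_gt0.
have n0 : 0 < n`!%:R :> R by rewrite ltr0n fact_gt0.
(* The summand 1 in [C1] makes the contradiction with [dn] strict. *)
apply: (@le_lt_trans _ _ (100 * a * (1 + b) * n`!%:R)); last first.
  by rewrite ltr_pM2r // /C1 ltrDl.
apply: (@le_trans _ _ (100 * a * (1 + b) * (K ^+ 3 * k`!%:R))); last first.
  by rewrite ler_wpM2l // !mulr_ge0 //; lra.
have -> : 100 * a * k`!%:R / eta * (1 + k.+1%:R * b / eta)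
    = 100 * a * k`!%:R * (eta^-1 * (1 + K * b * eta^-1)).
  by rewrite /K; ring.
have -> : 100 * a * (1 + b) * (K ^+ 3 * k`!%:R)
    = 100 * a * k`!%:R * ((1 + b) * K ^+ 3) by ring.
rewrite ler_wpM2l //; first by rewrite !mulr_ge0 //; lra.
apply: (@le_trans _ _ (K * (1 + K * b * K))).
  apply: ler_pM => //; first by rewrite invr_ge0 ltW.
    by rewrite addr_ge0 // !mulr_ge0 ?invr_ge0 ?(ltW K0) ?(ltW eta0) //; lra.
  by rewrite lerD2l ler_wpM2l // mulr_ge0 ?(ltW K0) //; lra.
have K1 : 1 <= K by rewrite /K ler1n.
have K2 : 1 <= K ^+ 2 by rewrite exprn_ege1.
have -> : K * (1 + K * b * K) = K + b * K ^+ 3 by ring.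
have -> : (1 + b) * K ^+ 3 = K * K ^+ 2 + b * K ^+ 3 by ring.
by rewrite lerD2r ler_peMr // ltW.
Qed.

Theorem theorem1p1 (R : realType) (rho : R -> R) (hrho : is_dickman_rho rho) :
  exists (c3 C1 C2 C3 : R), [/\ 0 < c3 < 1, 0 < C1, 0 < C2 & 0 < C3] /\
  exists X0 : R,
    (* (a) *)
    (forall (x0 eta delta : R), X0 <= x0 -> 0 < eta < 1 -> 0 < delta < 1 ->
     forall (d : nat) (f : nat -> algC), (1 <= d)%N -> classM1 x0 d f ->
       C1 / rho (C2 / (eta * delta)) <= d%:R ->
       d%:R <= C3 / (eta * delta) * expR (powR (ln x0) c3) ->
       forall x : R, powR x0 delta < x ->
         ln (eta^-1) <= sum_inv_primes_upto x (fun p => (f p != 0) && (f p != 1)))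
    /\
    (* (b) *)
    (forall c : R, 0 < c < c3 -> exists Q : nat,
     forall (x0 eta delta : R), X0 <= x0 -> 0 < eta < 1 -> 0 < delta < 1 ->
     forall (q d : nat) (f : nat -> algC), prime q -> (Q <= q)%N ->
       classM1 x0 d f -> primitive_char q f -> (d %| q.-1)%N ->
       powR (ln q%:R) (- c) <= eta * delta ->
       C1 / rho (C2 / (eta * delta)) <= d%:R ->
       forall x : R, powR x0 delta < x ->
         ln (eta^-1) <= sum_inv_primes_upto x (fun p => (f p != 0) && (f p != 1))).
Proof.
pose b : R := expR 107; pose a : R := expR 102.
have b0 : 0 < b by exact: expR_gt0.
have a0 : 0 < a by exact: expR_gt0.
have C1_gt0 : 0 < 100 * a * (1 + b) + 1.
  by rewrite addr_gt0 // !mulr_gt0 // addr_gt0.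
have C2_gt0 : 0 < 2 * b + 6 by rewrite addr_gt0 // mulr_gt0.
exists (1 / 2), (100 * a * (1 + b) + 1), (2 * b + 6), 1; split.
  by split => //; lra.
(* From 2 on, x0 + 2 <= x0^2, which places the good integers beyond x0. *)
exists 2; split.
  move=> x0 eta delta x02 eta01 delta01 d f _ hf hd _ x hx.
  exact: (classM1_sum_ge R rho hrho x0 eta delta x d f).
move=> c _; exists 0%N => x0 eta delta x02 eta01 delta01 q d f _ _ hf _ _ _ hd x hx.
exact: (classM1_sum_ge R rho hrho x0 eta delta x d f).
Qed.
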